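(* For a fixed, positive-definite, symmetric matrix $\Sigma=\begin{pmatrix}\sigma_1^2&\rho\\ \rho&\sigma_2^2\end{pmatrix}$ such that $|\sigma_1^2-\sigma_2^2|+|\rho|>0$, the function $\alpha\mapsto\beta_{\mathrm{c}}(\Sigma,\alpha)$ over the interval $[-\frac{\pi}{2},\frac{\pi}{2}]$, where $$\beta_{\mathrm{c}}(\Sigma,\alpha):=\frac{\sigma_1^2}{\sigma_2^2}+\left(\frac{\sigma_2^2-\sigma_1^2}{\sigma_2^2}\right)\sin^2\alpha+\frac{\rho}{\sigma_2^2}\sin2\alpha,$$ is strictly positive for $|\alpha|\le\pi/2$, with two stationary points, one in $(-\frac{\pi}{2},0)$ and the other in $(0,\frac{\pi}{2})$, at which the function takes its maximum/minimum values of $$\frac12+\frac{\sigma_1^2}{2\sigma_2^2}\pm\frac{1}{2\sigma_2^2}\sqrt{(\sigma_1^2-\sigma_2^2)^2+4\rho^2}.$$ The exception is the case where $\sigma_1^2-\sigma_2^2=\rho=0$, when $\beta_{\mathrm{c}}=1$ is constant.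
   Context: Here $\sigma_1,\sigma_2>0$, $\rho\in\mathbb{R}$, and positive-definiteness of $\Sigma$ means in particular $\rho^2<\sigma_1^2\sigma_2^2$.
   Formalization: The claim of one stationary point in each of (-π/2,0) and (0,π/2) is proved for ρ≠0; it fails for ρ=0, σ1≠σ2, where the stationary points are exactly -π/2, 0, π/2, and the same maximum/minimum values are shown to be taken there. *)

(* Defs.v *)
From HB Require Import structures.
From mathcomp Require Import all_boot all_order all_algebra.
From mathcomp Require Import all_classical all_reals all_analysis.

Set Implicit Arguments.
Unset Strict Implicit.
Unset Printing Implicit Defensive.

Import Order.TTheory GRing.Theory Num.Theory.
Import numFieldNormedType.Exports.

Local Open Scope classical_set_scope.
Local Open Scope ring_scope.

Definition posdefmx (R : realType) (n : nat) (S : 'M[R]_n) : Prop :=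
  forall v : 'cV[R]_n, v != 0 -> 0 < (v^T *m S *m v) ord0 ord0.

Definition Sigma_mx (R : realType) (sigma1 sigma2 rho : R) : 'M[R]_2 :=
  \matrix_(i < 2, j < 2)
    if i == j then (if i == 0 then sigma1 ^+ 2 else sigma2 ^+ 2) else rho.

(* The diagonal entries of S are the squares sigma1^2 and sigma2^2. *)
Definition betac (R : realType) (S : 'M[R]_2) (alpha : R) : R :=
  S 0 0 / S 1 1
  + (S 1 1 - S 0 0) / S 1 1 * (sin alpha) ^+ 2
  + S 0 1 / S 1 1 * sin (2 * alpha).

(* The derivative is two-sided.  As betac S is differentiable on the whole
   line, at an endpoint of an interval this agrees with the one-sided one. *)
Definition stationary (R : realType) (f : R -> R) (x : R) : Prop :=
  is_derive x 1 f 0.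

Definition max_on_at (R : realType) (D : set R) (f : R -> R) (M x : R) : Prop :=
  [/\ D x, f x = M & forall y, D y -> f y <= M].

Definition min_on_at (R : realType) (D : set R) (f : R -> R) (m x : R) : Prop :=
  [/\ D x, f x = m & forall y, D y -> m <= f y].

Definition extremal_value_max (R : realType) (sigma1 sigma2 rho : R) : R :=
  1 / 2 + sigma1 ^+ 2 / (2 * sigma2 ^+ 2)
  + 1 / (2 * sigma2 ^+ 2)
    * Num.sqrt ((sigma1 ^+ 2 - sigma2 ^+ 2) ^+ 2 + 4 * rho ^+ 2).

Definition extremal_value_min (R : realType) (sigma1 sigma2 rho : R) : R :=
  1 / 2 + sigma1 ^+ 2 / (2 * sigma2 ^+ 2)
  - 1 / (2 * sigma2 ^+ 2)
    * Num.sqrt ((sigma1 ^+ 2 - sigma2 ^+ 2) ^+ 2 + 4 * rho ^+ 2).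

(* Main.v *)
(* In the double angle, sigma2^2 * betac is a constant plus the sinusoid
   ((sigma1^2 - sigma2^2) cos 2a + 2 rho sin 2a) / 2, which in phase-amplitude
   form reads A cos (2 (a - b)) / 2 with |A| the square root in the statement
   and b in [0, pi/2).  Its critical points are b modulo pi/2, where the cosine
   is alternately 1 and -1; allowing A to be negative puts b in [0, pi/2), and
   b = 0 exactly when rho = 0.  Positivity holds because betac is the quadratic
   form of Sigma at (cos a, sin a), divided by sigma2^2. *)
Require Import Defs.
From HB Require Import structures.
From mathcomp Require Import all_boot all_order all_algebra.
From mathcomp Require Import all_classical all_reals all_analysis.
From mathcomp Require Import ring lra.
Import Order.TTheory GRing.Theory Num.Theory.
Import numFieldNormedType.Exports.
Local Open Scope classical_set_scope.
Local Open Scope ring_scope.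

(** Polar coordinates with a signed radius: opposite rays share an angle, so a half-turn is range
    enough for [t]. *)
Lemma phase_amplitude (R : realType) (x y : R) :
  exists A t : R,
    [/\ `|A| = Num.sqrt (x ^+ 2 + y ^+ 2), 0 <= t < pi,
        (y = 0 -> t = 0), (y != 0 -> 0 < t) & x = A * cos t /\ y = A * sin t].
Proof.
have [->|y0] := eqVneq y 0.
  exists x, 0; rewrite expr0n addr0 sqrtr_sqr lexx pi_gt0 cos0 sin0 mulr1 mulr0.
  by split.
have y2 : 0 < y ^+ 2 by rewrite exprn_even_gt0.
have N2 : 0 < x ^+ 2 + y ^+ 2 by have := sqr_ge0 x; lra.
(* The sign of [y] puts [(x / A, y / A)] on the open upper unit semicircle, where the arccosine of
   the first coordinate recovers the angle. *)
pose A := Num.sg y * Num.sqrt (x ^+ 2 + y ^+ 2).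
have A0 : A != 0 by rewrite mulf_neq0 ?sgr_eq0// gt_eqF// sqrtr_gt0.
have A2 : A ^+ 2 = x ^+ 2 + y ^+ 2.
  by rewrite exprMn sqr_sg y0 mul1r sqr_sqrtr// ltW.
have yA : 0 < y / A.
  rewrite {1}[y]numEsg /A -mulf_div divff ?sgr_eq0// mul1r.
  by rewrite divr_gt0 ?normr_gt0 ?sqrtr_gt0.
have xyA : (x / A) ^+ 2 + (y / A) ^+ 2 = 1.
  by rewrite !expr_div_n -mulrDl -A2 divff// expf_neq0.
have xA : -1 < x / A < 1.
  have yA2 : 0 < (y / A) ^+ 2 by rewrite exprn_gt0.
  rewrite -ltr_norml -(@ltr_pXn2r _ 2)// ?nnegrE// expr1n.
  by rewrite real_normK ?num_real//; lra.
have /andP[xAl xAr] := xA.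
have xA' : -1 <= x / A <= 1 by rewrite !ltW.
exists A, (acos (x / A)); split.
- by rewrite -sqrtr_sqr A2.
- by rewrite acos_ge0// acos_ltpi// xAl ltW.
- by move/eqP; rewrite (negPf y0).
- by move=> _; rewrite acos_gt0// xAr ltW.
- split; first by rewrite acosK ?in_itv//= mulrC divfK.
  have -> : sin (acos (x / A)) = y / A.
    rewrite sin_acos//; have -> : 1 - (x / A) ^+ 2 = (y / A) ^+ 2 by lra.
    by rewrite sqrtr_sqr gtr0_norm.
  by rewrite mulrC divfK.
Qed.

(** The zeros are those of sin t and cos t. The range (-pi, pi) contains every alpha - b with alpha
    in [-pi/2, pi/2] and b in [0, pi/2). *)
Lemma sin_double_eq0 (R : realType) (t : R) : - pi < t < pi ->
  sin (2 * t) = 0 <-> [\/ t = - (pi / 2), t = 0 | t = pi / 2].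
Proof.
move=> /andP[tl tr].
have sin20 : sin (2 * t) = (cos t * sin t) *+ 2 by rewrite mulr_natl sin_mulr2n.
split=> [|[]->]; last first.
- by rewrite mulrC divfK// sinpi.
- by rewrite mulr0 sin0.
- by rewrite mulrN mulrC divfK// sinN sinpi oppr0.
rewrite sin20 => /eqP; rewrite mulrn_eq0/= mulf_eq0 => /orP[] /eqP t0.
  (* The cosine is even, and injective on [0, pi]. *)
  have : `|t| = pi / 2.
    apply: cos_inj; rewrite ?in_itv/= ?normr_ge0 ?cos_norm ?t0 ?cos_pihalf//.
      by rewrite ler_norml !ltW.
    by have := @pi_gt0 R; lra.
  case: (ger0P t) => _ h; first by constructor 3.
  by constructor 1; rewrite -h opprK.
(* The sine has no zero in (0, pi), nor, being odd, in (-pi, 0). *)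
constructor 2; case: (ltrgtP t 0) => // ht.
  have := @sin_gt0_pi R (- t); rewrite sinN t0 oppr0 ltxx => H.
  by suff: false by []; apply: H; lra.
have := @sin_gt0_pi R t; rewrite t0 ltxx => H.
by suff: false by []; apply: H; lra.
Qed.

(** The derivative is -2 B sin (2 (x - b)), whose factor -2 B is nonzero. *)
Lemma stationary_sinusoid (R : realType) (f : R -> R) (K B b x : R) :
  B != 0 -> (forall a, f a = K + B * cos (2 * (a - b))) ->
  stationary f x <-> sin (2 * (x - b)) = 0.
Proof.
move=> B0 fE.
have df : is_derive x 1 f (- (2 * B) * sin (2 * (x - b))).
  have -> : f = cst K + B \*: (cos \o (2 \*: (id - cst b))).
    by apply/funext => a; rewrite fE.
  apply: is_derive_eq.
  rewrite /GRing.scale/= /GRing.scale/= !fctE.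
  ring.
rewrite /stationary; split=> [h|h].
  have := @derive_val _ _ _ _ _ _ _ df.
  rewrite (@derive_val _ _ _ _ _ _ _ h) => /esym/eqP.
  by rewrite mulf_eq0 oppr_eq0 mulf_eq0 pnatr_eq0 (negPf B0) => /eqP.
by rewrite h mulr0 in df.
Qed.

Lemma betacE (R : realType) (s1 s2 r a : R) :
  betac (Sigma_mx s1 s2 r) a =
  s1 ^+ 2 / s2 ^+ 2 + (s2 ^+ 2 - s1 ^+ 2) / s2 ^+ 2 * sin a ^+ 2
  + r / s2 ^+ 2 * sin (2 * a).
Proof. by rewrite /betac !mxE. Qed.

Lemma betac_quadratic_form (R : realType) (s1 s2 r a : R) : s2 != 0 ->
  let v := \col_(i < 2) (if i == 0 then cos a else sin a) in
  betac (Sigma_mx s1 s2 r) a =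
  (v^T *m Sigma_mx s1 s2 r *m v) ord0 ord0 / s2 ^+ 2.
Proof.
move=> s20 /=; rewrite betacE mulr_natl sin_mulr2n.
rewrite !mxE !big_ord_recl big_ord0 !mxE !big_ord_recl !big_ord0 !mxE/=.
have /eqP := cos2Dsin2 a; rewrite eq_sym -subr_eq => /eqP h.
(* Inserting cos^2 + sin^2 = 1 makes the constant term homogeneous of degree two, like the quadratic
   form. *)
have -> : s1 ^+ 2 / s2 ^+ 2 = s1 ^+ 2 * (cos a ^+ 2 + sin a ^+ 2) / s2 ^+ 2.
  by rewrite cos2Dsin2 mulr1.
by field.
Qed.

Lemma betac_gt0 (R : realType) (s1 s2 r a : R) : s2 != 0 ->
  posdefmx (Sigma_mx s1 s2 r) -> 0 < betac (Sigma_mx s1 s2 r) a.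
Proof.
move=> s20 pd; rewrite betac_quadratic_form//.
apply: divr_gt0; last by rewrite exprn_even_gt0.
apply: pd; apply/eqP => /matrixP v0.
have := v0 0 0; have := v0 1 0; rewrite !mxE/= => sa ca.
by have /eqP := cos2Dsin2 a; rewrite ca sa expr0n addr0 eq_sym oner_eq0.
Qed.

Lemma betac_sinusoid (R : realType) (s1 s2 r : R) : s2 != 0 ->
  exists A b : R,
    [/\ `|A| = Num.sqrt ((s1 ^+ 2 - s2 ^+ 2) ^+ 2 + 4 * r ^+ 2),
        0 <= b < pi / 2, (r = 0 -> b = 0), (r != 0 -> 0 < b) &
        forall a, betac (Sigma_mx s1 s2 r) a =
          1 / 2 + s1 ^+ 2 / (2 * s2 ^+ 2)
          + A / (2 * s2 ^+ 2) * cos (2 * (a - b))].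
Proof.
move=> s20.
(* The pair consists of the coefficients of cos 2a and sin 2a in [2 * s2 ^+ 2] times [betac]; half
   the phase [t] serves as [b]. *)
have [A [t [AE tb t0 tgt [xE yE]]]] :=
  phase_amplitude R (s1 ^+ 2 - s2 ^+ 2) (2 * r).
exists A, (t / 2); split.
- by rewrite AE exprMn; congr (Num.sqrt (_ + _ * _)); ring.
- by move: tb; lra.
- by move=> r0; rewrite t0 ?mul0r// r0 mulr0.
- by move=> r0; rewrite divr_gt0// tgt// mulf_neq0// pnatr_eq0.
move=> a.
have -> : 2 * (a - t / 2) = a *+ 2 - t by rewrite mulrBr mulrC mulr_natr; lra.
rewrite betacE cosB mulr_natl cos_mulr2n.
have -> : A / (2 * s2 ^+ 2) *
    ((cos a ^+ 2 *+ 2 - 1) * cos t + sin (a *+ 2) * sin t) =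
  ((cos a ^+ 2 *+ 2 - 1) * (A * cos t) + sin (a *+ 2) * (A * sin t))
    / (2 * s2 ^+ 2) by ring.
rewrite -xE -yE.
have -> : cos a ^+ 2 = 1 - sin a ^+ 2 by rewrite -(cos2Dsin2 a) addrK.
by field.
Qed.

Theorem proposition1p6 (R : realType) (sigma1 sigma2 rho : R)
    (hsigma1 : 0 < sigma1) (hsigma2 : 0 < sigma2)
    (hSigma : posdefmx (Sigma_mx sigma1 sigma2 rho)) :
  let f := betac (Sigma_mx sigma1 sigma2 rho) in
  let I := [set x : R | - (pi / 2) <= x <= pi / 2] in
  let M := extremal_value_max sigma1 sigma2 rho in
  let m := extremal_value_min sigma1 sigma2 rho in
  (0 < `|sigma1 ^+ 2 - sigma2 ^+ 2| + `|rho| ->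
     [/\ (forall alpha, I alpha -> 0 < f alpha),
         (* generic case: one stationary point in each open half *)
         (rho != 0 ->
            exists a1 a2 : R,
              [/\ - (pi / 2) < a1 < 0, 0 < a2 < pi / 2,
                  (forall alpha, I alpha ->
                     (stationary f alpha <-> alpha = a1 \/ alpha = a2)) &
                  (max_on_at I f M a1 /\ min_on_at I f m a2) \/
                  (min_on_at I f m a1 /\ max_on_at I f M a2)]) &
         (* boundary case rho = 0: the stationary points reach 0 and the
            endpoints, which are identified by pi-periodicity *)
         (rho = 0 ->
            (forall alpha, I alpha ->
               (stationary f alpha <->
                  [\/ alpha = - (pi / 2), alpha = 0 | alpha = pi / 2])) /\
            ([/\ max_on_at I f M 0, min_on_at I f m (- (pi / 2)) &
                 min_on_at I f m (pi / 2)] \/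
             [/\ min_on_at I f m 0, max_on_at I f M (- (pi / 2)) &
                 max_on_at I f M (pi / 2)]))])
  /\
  (sigma1 ^+ 2 - sigma2 ^+ 2 = 0 -> rho = 0 ->
     forall alpha, I alpha -> f alpha = 1).
Proof.
have s20 : sigma2 != 0 by rewrite gt_eqF.
move=> f I M m; split; last first.
  move=> /eqP; rewrite subr_eq0 => /eqP s12 r0 a _.
  by rewrite /f betacE s12 r0 subrr !mul0r !addr0 divff// expf_neq0.
move=> nondeg.
have [A [b [AE /andP[b0 bpi] rb0 rbgt fE]]] :=
  betac_sinusoid R sigma1 sigma2 rho s20.
rewrite -/f in fE.
set K := 1 / 2 + sigma1 ^+ 2 / (2 * sigma2 ^+ 2) in fE.
set B := A / (2 * sigma2 ^+ 2) in fE.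
have q0 : 0 < 2 * sigma2 ^+ 2 by rewrite mulr_gt0// exprn_gt0.
(* Nondegeneracy makes the radicand positive, so the sinusoid is not constant. *)
have A0 : A != 0.
  rewrite -normr_gt0 AE sqrtr_gt0; move: nondeg.
  have [->|rn0 _] := eqVneq rho 0.
    by rewrite normr0 addr0 normr_gt0 expr0n mulr0 addr0 exprn_even_gt0.
  by rewrite ltr_wpDl ?sqr_ge0// mulr_gt0// exprn_even_gt0.
have B0 : B != 0 by rewrite mulf_neq0// invr_eq0 gt_eqF.
(* Through [|B|] the extremal values become K + |B| and K - |B|, whatever the sign of [A]. *)
have normB : `|B| = 1 / (2 * sigma2 ^+ 2) * `|A|.
  by rewrite normrM normfV (gtr0_norm q0) mulrC div1r.
have ME : M = K + `|B| by rewrite normB AE.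
have mE : m = K - `|B| by rewrite normB AE.
(* These bounds hold on the whole line, so a point of [I] where [f] takes the value [M] or [m] is an
   extremum. *)
have fbnd y : m <= f y <= M.
  have cb : `|B * cos (2 * (y - b))| <= `|B|.
    by rewrite normrM ler_piMr// ler_norml cos_geN1 cos_le1.
  by move: cb; rewrite ME mE fE ler_norml; lra.
have fb : f b = K + B by rewrite fE subrr mulr0 cos0 mulr1.
(* A shift by pi/2 moves the double angle by pi, where the cosine is -1. *)
have fbB : f (b - pi / 2) = K - B.
  rewrite fE; have -> : 2 * (b - pi / 2 - b) = - pi by lra.
  by rewrite cosN cospi mulrN1.
have fbD : f (b + pi / 2) = K - B.
  rewrite fE; have -> : 2 * (b + pi / 2 - b) = pi by lra.
  by rewrite cospi mulrN1.
have maxI x : I x -> f x = M -> max_on_at I f M x.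
  by move=> Ix fx; split=> // y _; have /andP[] := fbnd y.
have minI x : I x -> f x = m -> min_on_at I f m x.
  by move=> Ix fx; split=> // y _; have /andP[] := fbnd y.
have pi0 := @pi_gt0 R.
have statE x : I x ->
    stationary f x <-> [\/ x = b - pi / 2, x = b | x = b + pi / 2].
  move=> Ix; apply: iff_trans (stationary_sinusoid _ _ _ _ _ _ B0 fE) _.
  apply: iff_trans (sin_double_eq0 _ _ _) _; first by move: Ix; rewrite /I/=; lra.
  by split=> -[] h; [constructor 1|constructor 2|constructor 3
    |constructor 1|constructor 2|constructor 3]; lra.
split.
- by move=> a _; exact: betac_gt0.
(* Now 0 < b < pi/2: [b - pi / 2] and [b] lie in the two open halves, while [b + pi / 2] falls
   outside [I]. *)
- move=> /rbgt bgt0; exists (b - pi / 2), b; split; [lra|lra| |].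
    move=> x Ix; apply: iff_trans (statE x Ix) _.
    split=> [[->|->|xE]|[]->];
      [by left|by right| |by constructor 1|by constructor 2].
    by move: Ix; rewrite /I/= xE; lra.
  have Ib : I b by rewrite /I/=; lra.
  have IbB : I (b - pi / 2) by rewrite /I/=; lra.
  (* The sign of [B] decides whether [b] is the maximum or the minimum. *)
  have [Bp|Bn] := lerP 0 B; [right|left]; split.
  + by apply: minI => //; rewrite fbB mE ger0_norm.
  + by apply: maxI => //; rewrite fb ME ger0_norm.
  + by apply: maxI => //; rewrite fbB ME ltr0_norm.
  + by apply: minI => //; rewrite fb mE ltr0_norm// opprK.
(* Now b = 0, so all three candidates, 0 and the two endpoints, lie in [I]. *)
- move=> /rb0 b00; rewrite b00 ?sub0r ?add0r in fb fbB fbD statE; split=> //.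
  have I0 : I 0 by rewrite /I/=; lra.
  have Il : I (- (pi / 2)) by rewrite /I/=; lra.
  have Ir : I (pi / 2) by rewrite /I/=; lra.
  have [Bp|Bn] := lerP 0 B; [left|right]; split.
  + by apply: maxI => //; rewrite fb ME ger0_norm.
  + by apply: minI => //; rewrite fbB mE ger0_norm.
  + by apply: minI => //; rewrite fbD mE ger0_norm.
  + by apply: minI => //; rewrite fb mE ltr0_norm// opprK.
  + by apply: maxI => //; rewrite fbB ME ltr0_norm.
  + by apply: maxI => //; rewrite fbD ME ltr0_norm.
Qed.
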